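(* Let $\Omega$ be a locally compact Hausdorff space and let $G \subset \mathrm{Aut}^+_s(C_0(\Omega))$ be a compact group. Then there exist a unique compact group $H \subset \mathrm{Homeo}(\Omega)$ and an $m \in C_b(\Omega)^{++}$ such that \[ G = mHm^{-1}. \] Conversely, any compact group $H \subset \mathrm{Homeo}(\Omega)$ and $m \in C_b(\Omega)^{++}$ define a compact group $G \subset \mathrm{Aut}^+_s(C_0(\Omega))$ by $G := mHm^{-1}$.
   Context: $C_0(\Omega)$ is the Banach lattice of real-valued continuous functions on $\Omega$ vanishing at infinity, with the supremum norm. $\mathrm{Aut}^+_s(C_0(\Omega))$ is the group of lattice automorphisms of $C_0(\Omega)$ with the strong operator topology. $\mathrm{Homeo}(\Omega)$ is the group of homeomorphisms of $\Omega$, identified with a subgroup of $\mathrm{Aut}^+_s(C_0(\Omega))$ (namely the group of isometric lattice automorphisms) via $\phi x := x\circ\phi^{-1}$ for $x\in C_0(\Omega)$, and equipped with the strong operator topology. $C_b(\Omega)^{++}$ is the set of bounded continuous functions $m$ on $\Omega$ for which there is a $\delta>0$ with $m(\omega)\ge\delta$ for all $\omega\in\Omega$; such $m$ is identified with the operator of pointwise multiplication by $m$ on $C_0(\Omega)$. *)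

(* Defs.v *)
From HB Require Import structures.
From mathcomp Require Import all_boot all_order all_algebra.
From mathcomp Require Import all_classical all_reals all_analysis.

Set Implicit Arguments.
Unset Strict Implicit.
Unset Printing Implicit Defensive.

Import Order.TTheory GRing.Theory Num.Theory.
Import numFieldNormedType.Exports.

Local Open Scope classical_set_scope.
Local Open Scope ring_scope.

Section c0.
Context (R : realType) (T : topologicalType).

Definition vanishes_at_infinity (f : T -> R) :=
  forall e : R, 0 < e ->
    exists2 K : set T, compact K & forall w, ~ K w -> `|f w| < e.

Definition c0_set : set (T -> R) :=
  [set f | continuous f /\ vanishes_at_infinity f].

Definition c0_pred : {pred T -> R} := mem c0_set.

Record c0 := C0Fun { c0_fun :> T -> R; c0_subproof : c0_fun \in c0_pred }.

HB.instance Definition _ := [isSub for c0_fun].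
HB.instance Definition _ := [Choice of c0 by <:].

Lemma c0_continuous (f : c0) : continuous f.
Proof. by have /set_mem[] := c0_subproof f. Qed.

Lemma c0_vanishes (f : c0) : vanishes_at_infinity f.
Proof. by have /set_mem[] := c0_subproof f. Qed.

Lemma c0P (f g : c0) : (forall w, f w = g w) -> f = g.
Proof. by move=> fg; apply/val_inj/funext. Qed.

Fact c0_submod_closed : submod_closed c0_pred.
Proof.
split.
  apply/mem_set; split; first by move=> x; exact: cvg_cst.
  by move=> e e0; exists set0; [exact: compact0|move=> w _; rewrite normr0].
move=> a f g /set_mem[cf vf] /set_mem[cg vg]; apply/mem_set; split.
  by move=> x; apply: cvgD; [apply: cvgZl_tmp; exact: cf|exact: cg].
move=> e e0.
have a0 : 0 < `|a| + 1 by rewrite ltr_wpDl.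
have [K cK Kf] := vf (e / 2 / (`|a| + 1)) ltac:(by rewrite !divr_gt0).
have [L cL Lg] := vg (e / 2) ltac:(by rewrite divr_gt0).
exists (K `|` L); first exact: compactU.
move=> w /not_orP[Kw Lw].
rewrite [e]splitr (le_lt_trans (ler_normD _ _))// ltr_leD//; last first.
  exact/ltW/Lg.
rewrite [X in X < _](_ : _ = `|a| * `|f w|); last by rewrite -normrM.
apply: (@le_lt_trans _ _ ((`|a| + 1) * `|f w|)).
  by rewrite ler_wpM2r// lerDl.
by rewrite -ltr_pdivlMl// mulrC Kf.
Qed.

HB.instance Definition _ := GRing.isSubmodClosed.Build _ _ c0_pred
  c0_submod_closed.
HB.instance Definition _ := [SubChoice_isSubLmodule of c0 by <:].

Fact c0_meet_closed : {in c0_pred &, forall f g, (f `&` g)%O \in c0_pred}.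
Proof.
move=> f g /set_mem[cf vf] /set_mem[cg vg]; apply/mem_set; split.
  move=> x; rewrite (_ : (f `&` g)%O = f \min g); last first.
    by apply/funext => w; rewrite meetfE meetEtotal.
  by apply: continuous_min; [exact: cf|exact: cg].
move=> e e0; have [K cK Kf] := vf _ e0; have [L cL Lg] := vg _ e0.
exists (K `|` L); first exact: compactU.
by move=> w /not_orP[/Kf fw /Lg gw]; rewrite meetfE meetEtotal /Order.min; case: ifP.
Qed.

Fact c0_join_closed : {in c0_pred &, forall f g, (f `|` g)%O \in c0_pred}.
Proof.
move=> f g /set_mem[cf vf] /set_mem[cg vg]; apply/mem_set; split.
  move=> x; rewrite (_ : (f `|` g)%O = f \max g); last first.
    by apply/funext => w; rewrite joinfE joinEtotal.
  by apply: continuous_max; [exact: cf|exact: cg].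
move=> e e0; have [K cK Kf] := vf _ e0; have [L cL Lg] := vg _ e0.
exists (K `|` L); first exact: compactU.
by move=> w /not_orP[/Kf fw /Lg gw]; rewrite joinfE joinEtotal /Order.max; case: ifP.
Qed.

(* the pointwise order, inherited from that of T -> R *)
HB.instance Definition _ := Order.isLatticeClosed.Build _ _ c0_pred
  c0_meet_closed c0_join_closed.
HB.instance Definition _ := [SubChoice_isSubLattice of c0 by <: with FunOrder.fun_display].

Lemma c0_has_ubound (f : c0) : has_ubound [set `|f w| | w in [set: T]].
Proof.
have [K cK Kf] := @c0_vanishes f 1 ltr01.
have : compact (f @` K).
  apply: continuous_compact => //.
  by apply: continuous_subspaceT; exact: c0_continuous.
move=> /compact_bounded[M [_ MK]].
exists (Num.max 1 (M + 1)) => _ [w _ <-].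
have [Kw|Kw] := pselect (K w); rewrite le_max.
  apply/orP; right; apply: (MK (M + 1)); first by rewrite ltrDl.
  by exists w.
by rewrite (ltW (Kf _ Kw)).
Qed.

Definition c0_norm (f : c0) : R := sup [set `|f w| | w in [set: T]].

Lemma c0_norm_ge (f : c0) w : `|f w| <= c0_norm f.
Proof. by apply: ub_le_sup; [exact: c0_has_ubound|exists w]. Qed.

(* When T is empty the supremum is that of the empty set, which is 0. *)
Lemma c0_norm_le (f : c0) M : 0 <= M -> (forall w, `|f w| <= M) ->
  c0_norm f <= M.
Proof.
move=> M0 fM; rewrite /c0_norm.
have [->|/set0P A0] := eqVneq [set `|f w| | w in [set: T]] set0.
  by rewrite sup0.
by apply: ge_sup => // _ [w _ <-].
Qed.

Lemma c0_norm_ge0 (f : c0) : 0 <= c0_norm f.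
Proof.
rewrite /c0_norm.
have [->|/set0P[_ [w _ _]]] := eqVneq [set `|f w| | w in [set: T]] set0.
  by rewrite sup0.
exact: le_trans (c0_norm_ge f w).
Qed.

Fact c0_normD (f g : c0) : c0_norm (f + g) <= c0_norm f + c0_norm g.
Proof.
apply: c0_norm_le => [|w]; first by rewrite addr_ge0// c0_norm_ge0.
by rewrite (le_trans (ler_normD _ _))// lerD// c0_norm_ge.
Qed.

Fact c0_normZ (a : R) (f : c0) : c0_norm (a *: f) = `|a| * c0_norm f.
Proof.
have le b g : c0_norm (b *: g) <= `|b| * c0_norm g.
  apply: c0_norm_le => [|w]; first by rewrite mulr_ge0// c0_norm_ge0.
  by rewrite [(b *: g) w](_ : _ = b * g w)// normrM ler_wpM2l// c0_norm_ge.
apply/eqP; rewrite eq_le le/=.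
have [->|a0] := eqVneq a 0; first by rewrite normr0 mul0r c0_norm_ge0.
rewrite -ler_pdivlMl ?normr_gt0// -normfV.
by have := le a^-1 (a *: f); rewrite scalerA mulVf// scale1r.
Qed.

Fact c0_norm0_eq0 (f : c0) : c0_norm f = 0 -> f = 0.
Proof.
move=> f0; apply: c0P => w; apply/eqP.
by rewrite -normr_le0 -f0 c0_norm_ge.
Qed.

HB.instance Definition _ := Lmodule_isNormed.Build R c0
  c0_normD c0_normZ c0_norm0_eq0.

End c0.

(* A group with a topology. Continuity of the operations is not assumed: in the
   strong operator topology, composition need not be jointly continuous on the whole
   group of lattice automorphisms, although on a compact subgroup composition
   and inversion are automatically continuous. *)
#[short(type="groupTopType")]
HB.structure Definition GroupTop := { G of Group G & Topological G }.

Definition compact_group (K : groupTopType) (G : set K) :=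
  group_closed [in G] /\ compact G.

Section lattice_automorphisms.
Context (R : realType) (T : topologicalType).
Local Notation C0 := (c0 R T).

(* Boundedness is automatic for lattice homomorphisms of a Banach lattice. *)
Record lataut := LatAut {
  lataut_fun :> C0 -> C0;
  lataut_inv : C0 -> C0;
  lataut_linear : linear lataut_fun;
  lataut_meet : {morph lataut_fun : x y / (x `&` y)%O};
  lataut_join : {morph lataut_fun : x y / (x `|` y)%O};
  latautK : cancel lataut_fun lataut_inv;
  latautVK : cancel lataut_inv lataut_fun }.

Lemma latautP (S S' : lataut) : (forall x, S x = S' x) -> S = S'.
Proof.
case: S S' => [f f' lf mf jf fK f'K] [g g' lg mg jg gK g'K] /= fg.
have {}fg : f = g by exact/funext.
subst g; have gf' : f' = g' by apply/funext => x; rewrite -{1}(g'K x) fK.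
by subst g'; congr LatAut; exact: Prop_irrelevance.
Qed.

HB.instance Definition _ := gen_eqMixin lataut.
HB.instance Definition _ := gen_choiceMixin lataut.

Definition lataut_one : lataut :=
  @LatAut idfun idfun (fun _ _ _ => erefl) (fun _ _ => erefl)
    (fun _ _ => erefl) (fun _ => erefl) (fun _ => erefl).

Program Definition lataut_mul (S S' : lataut) : lataut :=
  @LatAut (S \o S') (lataut_inv S' \o lataut_inv S) _ _ _ _ _.
Next Obligation. by move=> S S' a x y /=; rewrite !lataut_linear. Qed.
Next Obligation. by move=> S S' x y /=; rewrite !lataut_meet. Qed.
Next Obligation. by move=> S S' x y /=; rewrite !lataut_join. Qed.
Next Obligation. by move=> S S' x /=; rewrite !latautK. Qed.
Next Obligation. by move=> S S' x /=; rewrite !latautVK. Qed.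

Program Definition lataut_invg (S : lataut) : lataut :=
  @LatAut (lataut_inv S) S _ _ _ (@latautVK S) (@latautK S).
Next Obligation.
move=> S a x y; apply: (can_inj (@latautK S)).
by rewrite lataut_linear !latautVK.
Qed.
Next Obligation.
move=> S x y; apply: (can_inj (@latautK S)).
by rewrite lataut_meet !latautVK.
Qed.
Next Obligation.
move=> S x y; apply: (can_inj (@latautK S)).
by rewrite lataut_join !latautVK.
Qed.

Fact lataut_mulA : associative lataut_mul.
Proof. by move=> S S' S''; exact: latautP. Qed.
Fact lataut_mul1 : left_id lataut_one lataut_mul.
Proof. by move=> S; exact: latautP. Qed.
Fact lataut_mulr1 : right_id lataut_one lataut_mul.
Proof. by move=> S; exact: latautP. Qed.
Fact lataut_mulV : left_inverse lataut_one lataut_invg lataut_mul.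
Proof. by move=> S; apply: latautP => x /=; rewrite latautK. Qed.
Fact lataut_mulrV : right_inverse lataut_one lataut_invg lataut_mul.
Proof. by move=> S; apply: latautP => x /=; rewrite latautVK. Qed.

HB.instance Definition _ := isGroup.Build lataut
  lataut_mulA lataut_mul1 lataut_mulr1 lataut_mulV lataut_mulrV.

(* strong operator topology: pointwise convergence in the norm of c0 *)
HB.instance Definition _ := Topological.copy lataut
  (initial_topology (lataut_fun : lataut -> {ptws C0 -> C0})).

End lattice_automorphisms.

Section homeomorphisms.
Context (T : topologicalType).

Record homeo := Homeo {
  homeo_fun :> T -> T;
  homeo_inv : T -> T;
  homeo_continuous : continuous homeo_fun;
  homeo_inv_continuous : continuous homeo_inv;
  homeoK : cancel homeo_fun homeo_inv;
  homeoVK : cancel homeo_inv homeo_fun }.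

Lemma homeoP (h k : homeo) : (forall w, h w = k w) -> h = k.
Proof.
case: h k => [f f' cf cf' fK f'K] [g g' cg cg' gK g'K] /= fg.
have {}fg : f = g by exact/funext.
subst g; have gf' : f' = g' by apply/funext => x; rewrite -{1}(g'K x) fK.
by subst g'; congr Homeo; exact: Prop_irrelevance.
Qed.

HB.instance Definition _ := gen_eqMixin homeo.
HB.instance Definition _ := gen_choiceMixin homeo.

Definition homeo_one : homeo :=
  @Homeo idfun idfun (fun _ => cvg_id) (fun _ => cvg_id)
    (fun _ => erefl) (fun _ => erefl).

Program Definition homeo_mul (h k : homeo) : homeo :=
  @Homeo (h \o k) (homeo_inv k \o homeo_inv h) _ _ _ _.
Next Obligation.
by move=> h k x; apply: continuous_comp; exact: homeo_continuous.
Qed.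
Next Obligation.
by move=> h k x; apply: continuous_comp; exact: homeo_inv_continuous.
Qed.
Next Obligation. by move=> h k x /=; rewrite !homeoK. Qed.
Next Obligation. by move=> h k x /=; rewrite !homeoVK. Qed.

Definition homeo_invg (h : homeo) : homeo :=
  Homeo (@homeo_inv_continuous h) (@homeo_continuous h)
    (@homeoVK h) (@homeoK h).

Fact homeo_mulA : associative homeo_mul.
Proof. by move=> h k l; exact: homeoP. Qed.
Fact homeo_mul1 : left_id homeo_one homeo_mul.
Proof. by move=> h; exact: homeoP. Qed.
Fact homeo_mulr1 : right_id homeo_one homeo_mul.
Proof. by move=> h; exact: homeoP. Qed.
Fact homeo_mulV : left_inverse homeo_one homeo_invg homeo_mul.
Proof. by move=> h; apply: homeoP => x /=; rewrite homeoK. Qed.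
Fact homeo_mulrV : right_inverse homeo_one homeo_invg homeo_mul.
Proof. by move=> h; apply: homeoP => x /=; rewrite homeoVK. Qed.

HB.instance Definition _ := isGroup.Build homeo
  homeo_mulA homeo_mul1 homeo_mulr1 homeo_mulV homeo_mulrV.

End homeomorphisms.

Section composition_operator.
Context (R : realType) (T : topologicalType).
Local Notation C0 := (c0 R T).

Fact comp_op_subproof (h : homeo T) (x : C0) :
  x \o homeo_inv h \in @c0_pred R T.
Proof.
apply/mem_set; split=> [w|e e0].
  by apply: continuous_comp; [exact: homeo_inv_continuous|exact: c0_continuous].
have [K cK Kx] := @c0_vanishes _ _ x _ e0.
exists (h @` K) => [|w hKw].
  apply: continuous_compact => //; apply: continuous_subspaceT.
  exact: homeo_continuous.
by apply: Kx => Kw; apply: hKw; exists (homeo_inv h w) => //; rewrite homeoVK.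
Qed.

Definition comp_fun (h : homeo T) (x : C0) : C0 := C0Fun (comp_op_subproof h x).

Fact comp_fun_linear h : linear (comp_fun h).
Proof. by move=> a x y; exact: c0P. Qed.
Fact comp_fun_meet h : {morph comp_fun h : x y / (x `&` y)%O}.
Proof. by move=> x y; exact: c0P. Qed.
Fact comp_fun_join h : {morph comp_fun h : x y / (x `|` y)%O}.
Proof. by move=> x y; exact: c0P. Qed.
Fact comp_funK h : cancel (comp_fun h) (comp_fun (h^-1)%g).
Proof. by move=> x; apply: c0P => w /=; rewrite homeoK. Qed.
Fact comp_funVK h : cancel (comp_fun (h^-1)%g) (comp_fun h).
Proof. by move=> x; apply: c0P => w /=; rewrite homeoVK. Qed.

(* x |-> x \o h^-1 *)
Definition comp_op (h : homeo T) : lataut R T :=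
  LatAut (@comp_fun_linear h) (@comp_fun_meet h) (@comp_fun_join h)
    (@comp_funK h) (@comp_funVK h).

Lemma comp_opE h (x : C0) w : comp_op h x w = x ((h^-1)%g w).
Proof. by []. Qed.

Lemma comp_opM h k : comp_op (h * k)%g = (comp_op h * comp_op k)%g.
Proof. by apply: latautP => x; exact: c0P. Qed.

(* homeo T with the strong operator topology of its image under comp_op; an
   alias because this topology depends on R *)
Definition homeo_sot : Type := initial_topology comp_op.

HB.instance Definition _ := Topological.on homeo_sot.
HB.instance Definition _ := Group.copy homeo_sot (homeo T).

End composition_operator.

Section multiplication_operator.
Context (R : realType) (T : topologicalType).
Local Notation C0 := (c0 R T).

(* C_b(T)^{++} *)
Record cbpp := Cbpp {
  cbpp_fun :> T -> R;
  cbpp_continuous : continuous cbpp_fun;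
  cbpp_bounded : bounded_fun cbpp_fun;
  cbpp_ge : exists2 d : R, 0 < d & forall w, d <= cbpp_fun w }.

Lemma cbpp_gt0 (m : cbpp) w : 0 < m w.
Proof. by have [d d0 dm] := cbpp_ge m; exact: lt_le_trans (dm w). Qed.

Fact cbpp_inv_continuous (m : cbpp) : continuous (fun w => (m w)^-1).
Proof.
move=> w; apply: continuousV; first by rewrite gt_eqF// cbpp_gt0.
exact: cbpp_continuous.
Qed.

Fact cbpp_inv_bounded (m : cbpp) : bounded_fun (fun w => (m w)^-1).
Proof.
have [d d0 dm] := cbpp_ge m; exists d^-1; split; first exact: num_real.
move=> M /ltW dM w _ /=; apply: le_trans dM.
by rewrite ger0_norm ?invr_ge0 ?(ltW (cbpp_gt0 _ _))// lef_pV2 ?posrE ?cbpp_gt0.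
Qed.

Fact cbpp_inv_ge (m : cbpp) :
  exists2 d : R, 0 < d & forall w, d <= (m w)^-1.
Proof.
have [M [_ MP]] := cbpp_bounded m.
have M0 : 0 < `|M| + 1 by rewrite ltr_wpDl.
exists (`|M| + 1)^-1 => [|w]; first by rewrite invr_gt0.
rewrite lef_pV2 ?posrE ?cbpp_gt0//; apply: le_trans (ler_norm _) _.
by apply: (MP (`|M| + 1)) => //; rewrite (le_lt_trans (ler_norm _))// ltrDl.
Qed.

Definition cbpp_inv (m : cbpp) : cbpp :=
  Cbpp (@cbpp_inv_continuous m) (@cbpp_inv_bounded m) (@cbpp_inv_ge m).

Fact mul_fun_subproof (m : cbpp) (x : C0) :
  (fun w => m w * x w) \in @c0_pred R T.
Proof.
apply/mem_set; split=> [w|e e0].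
  by apply: continuousM; [exact: cbpp_continuous|exact: c0_continuous].
have [d d0 dm] := cbpp_inv_ge m.
have [K cK Kx] := @c0_vanishes _ _ x (d * e) (mulr_gt0 d0 e0).
exists K => // w /Kx xw.
rewrite normrM gtr0_norm ?cbpp_gt0// -ltr_pdivlMl ?cbpp_gt0//.
by rewrite (lt_le_trans xw)// ler_wpM2r// ltW.
Qed.

Definition mul_fun (m : cbpp) (x : C0) : C0 := C0Fun (mul_fun_subproof m x).

Fact mul_fun_linear m : linear (mul_fun m).
Proof.
move=> a x y; apply: c0P => w.
rewrite -[LHS]/(m w * (a * x w + y w)).
by rewrite mulrDr mulrCA.
Qed.
Fact mul_fun_meet m : {morph mul_fun m : x y / (x `&` y)%O}.
Proof.
move=> x y; apply: c0P => w.
rewrite -[LHS]/(m w * (x w `&` y w)%O) -[RHS]/(m w * x w `&` m w * y w)%O.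
by rewrite !meetEtotal minr_pMr// ltW// cbpp_gt0.
Qed.
Fact mul_fun_join m : {morph mul_fun m : x y / (x `|` y)%O}.
Proof.
move=> x y; apply: c0P => w.
rewrite -[LHS]/(m w * (x w `|` y w)%O) -[RHS]/(m w * x w `|` m w * y w)%O.
by rewrite !joinEtotal maxr_pMr// ltW// cbpp_gt0.
Qed.
Fact mul_funK m : cancel (mul_fun m) (mul_fun (cbpp_inv m)).
Proof.
by move=> x; apply: c0P => w /=; rewrite mulKf// gt_eqF// cbpp_gt0.
Qed.
Fact mul_funVK m : cancel (mul_fun (cbpp_inv m)) (mul_fun m).
Proof.
by move=> x; apply: c0P => w /=; rewrite mulVKf// gt_eqF// cbpp_gt0.
Qed.

Definition mul_op (m : cbpp) : lataut R T :=
  LatAut (@mul_fun_linear m) (@mul_fun_meet m) (@mul_fun_join m)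
    (@mul_funK m) (@mul_funVK m).

Definition conj_group (m : cbpp) (H : set (homeo_sot R T)) :
    set (lataut R T) :=
  [set (mul_op m * comp_op R h * (mul_op m)^-1)%g | h in H].

End multiplication_operator.

(* Main.v *)
(* A lattice automorphism S of C_0(T) is a weighted composition operator,
   S x w = weight S w * x (point S w), and the weights satisfy the cocycle identity
   weight (S * S') w = weight S w * weight S' (point S w).  For a compact group G
   put m w := sup_(S in G) weight S w.  Since left multiplication by S permutes G,
   m w = weight S w * m (point S w), which says exactly that m^-1 * S * m is
   composition with point S; no Haar measure is needed.  The supremum is finite by
   a gliding hump argument, at least 1 because G contains the identity, and
   continuous because weight is jointly continuous and G is compact.  The group H
   is unique because the points of a weighted composition operator are. *)
From HB Require Import structures.
Require Import Defs.
From mathcomp Require Import all_boot all_order all_algebra.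
From mathcomp Require Import all_classical all_reals all_analysis.
From mathcomp Require Import lra.

Set Implicit Arguments.
Unset Strict Implicit.
Unset Printing Implicit Defensive.

Import Order.TTheory GRing.Theory Num.Theory.
Import numFieldNormedType.Exports.

Local Open Scope classical_set_scope.
Local Open Scope ring_scope.

(** * Order, dominating functions and bump functions in [c0] *)

Section c0_theory.
Context {R : realType} {T : topologicalType}.
Local Notation C0 := (c0 R T).
Implicit Types (x y : C0) (w v : T).

Lemma c0_joinE x y w : (x `|` y)%O w = Num.max (x w) (y w).
Proof. by rewrite -[LHS]/((x w) `|` (y w))%O joinEtotal. Qed.

Definition c0_abs x : C0 := (x `|` - x)%O.

Lemma c0_absE x w : c0_abs x w = `|x w|.
Proof. by rewrite c0_joinE -[(- x) w]/(- x w) real_maxrN// num_real. Qed.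

Fact c0_sqrt_subproof x :
  (fun w => Num.sqrt (x w)) \in @c0_pred R T.
Proof.
apply/mem_set; split=> [w|e e0].
  apply: (@continuous_comp _ _ _ x Num.sqrt); first exact: c0_continuous.
  exact: sqrt_continuous.
have [K cK Kx] := @c0_vanishes _ _ x (e ^+ 2) (exprn_gt0 _ e0).
exists K => // w /Kx xw; rewrite ger0_norm ?sqrtr_ge0//.
rewrite -(ltr_pXn2r (ltn0Sn 1)) ?nnegrE ?sqrtr_ge0 ?(ltW e0)//.
(* [Num.sqrt] is 0 on negative numbers, so the bound is immediate there. *)
have [x0|x0] := leP 0 (x w).
  by rewrite sqr_sqrtr// (le_lt_trans (ler_norm _)).
by rewrite ler0_sqrtr ?(ltW x0)// expr0n exprn_gt0.
Qed.

Definition c0_sqrt x : C0 := C0Fun (c0_sqrt_subproof x).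

(** Serves to place a pointwise supremum, whose continuity is not known beforehand, in [c0]. *)
Lemma c0_uniform_limit (f : T -> R) :
  (forall e, 0 < e -> exists x, forall w, `|f w - x w| <= e) ->
  f \in @c0_pred R T.
Proof.
move=> fx; apply/mem_set; split=> [w|e e0].
  apply/cvgrPdist_lt => e e0.
  have [x xe] := fx (e / 4) ltac:(by rewrite divr_gt0).
  have /cvgrPdist_lt/(_ (e / 4) ltac:(by rewrite divr_gt0)) :=
    @c0_continuous _ _ x w.
  apply: filterS => v xwv.
  have := xe w; have := xe v; move: xwv.
  rewrite !(ltr_norml, ler_norml) => /andP[? ?] /andP[? ?] /andP[? ?].
  by apply/andP; split; lra.
have [x xe] := fx (e / 2) ltac:(by rewrite divr_gt0).
have [K cK Kx] := @c0_vanishes _ _ x (e / 2) ltac:(by rewrite divr_gt0).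
exists K => // w /Kx; have := xe w.
rewrite !(ltr_norml, ler_norml) => /andP[? ?] /andP[? ?].
by apply/andP; split; lra.
Qed.

(* Replaces completeness of C_0(T) in the gliding hump argument. *)
Lemma c0_dominating (b : nat -> C0) :
  (forall n w, 0 <= b n w <= 1) ->
  exists x, forall n w, 2^-1 ^+ n * b n w <= x w.
Proof.
move=> b01.
pose A w := [set 2^-1 ^+ n * b n w | n in [set: nat]].
have h0 n : 0 < 2^-1 ^+ n :> R by rewrite exprn_gt0.
have h1 n : 2^-1 ^+ n <= 1 :> R by rewrite exprn_ile1 ?invr_ge0 ?invf_le1 ?ler1n.
have bA w n : 2^-1 ^+ n * b n w <= 2^-1 ^+ n.
  by rewrite ler_piMr ?(ltW (h0 _))//; have /andP[] := b01 n w.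
have ubA w : has_ubound (A w).
  by exists 1 => _ [n _ <-]; apply: le_trans (h1 n); exact: bA.
have A0 w : A w !=set0 by exists (2^-1 ^+ 0 * b 0%N w), 0%N.
have bsup w n : 2^-1 ^+ n * b n w <= sup (A w).
  by apply: ub_le_sup => //; exists n.
suff f0 : (fun w => sup (A w)) \in @c0_pred R T by exists (C0Fun f0).
(* [s N] is the maximum of 0 and the first [N] terms. The later terms are at most [2^-1 ^+ N], so
   these maxima converge uniformly to the supremum. *)
pose s := fix s N : C0 := if N is n.+1 then (s n `|` 2^-1 ^+ n *: b n)%O else 0.
have sE N w : s N.+1 w = Num.max (s N w) (2^-1 ^+ N * b N w).
  exact: (c0_joinE (s N) (2^-1 ^+ N *: b N)).
have s0 N w : 0 <= s N w.
  by elim: N => [|N IH]; rewrite ?sE// le_max IH.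
have sb N n w : (n < N)%N -> 2^-1 ^+ n * b n w <= s N w.
  elim: N => [|N IH]//; rewrite ltnS leq_eqVlt sE le_max => /orP[/eqP->|/IH->//].
  by rewrite lexx orbT.
have sf N w : s N w <= sup (A w).
  elim: N => [|N IH]; last by rewrite sE ge_max IH bsup.
  by apply: le_trans (bsup w 0%N); rewrite mulr_ge0 ?(ltW (h0 _))//;
    have /andP[] := b01 0%N w.
apply: c0_uniform_limit => e e0.
have [N Ne] : exists N, 2^-1 ^+ N <= e.
  have : 2^-1 ^+ n @[n --> \oo] --> (0 : R).
    by apply: cvg_expr; rewrite ger0_norm// invf_lt1// ltr1n.
  move=> /cvgrPdist_le/(_ _ e0)[N _ /(_ N (leqnn _))] /=.
  by rewrite sub0r normrN ger0_norm ?(ltW (h0 _))//; exists N.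
exists (s N) => w; rewrite ger0_norm ?subr_ge0// lerBlDr.
apply: ge_sup => // _ [n _ <-].
have [nN|Nn] := ltnP n N; first by rewrite (le_trans (sb N n w nN))// lerDr ltW.
rewrite (le_trans (bA _ _))// (@le_trans _ _ e) ?lerDl//.
by apply: le_trans Ne; rewrite ler_wiXn2l ?invr_ge0 ?invf_le1 ?ler1n ?ltr0n.
Qed.

(** Complete regularity separates [w] from the complement of an open [V] inside a compact set. The
    value 1 is reached on a whole neighbourhood so that weights can later be read off as values
    [S x w] with [x] fixed. *)
Lemma c0_bump (hT : hausdorff_space T) (lcT : locally_compact [set: T])
    w (U : set T) : nbhs w U ->
  exists x, [/\ forall v, 0 <= x v <= 1, \forall v \near w, x v = 1 &
    forall v, x v != 0 -> U v].
Proof.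
move=> Uw; have [K + [cK _]] := lcT w I; rewrite withinET => wK.
pose V := interior (K `&` U).
have VwK : V `<=` K by move=> v /interior_subset[].
have VwU : V `<=` U by move=> v /interior_subset[].
have Vw : V w by exact: filterI.
have clV : closed (~` V) by rewrite closedC; exact: open_interior.
have := @locally_compact_completely_regular T R lcT hT w (~` V) clV
  (fun h => h Vw).
move=> /(@uniform_separatorP T R)[f [cf f01 fw fV]].
have {}f01 v : 0 <= f v <= 1.
  by have := f01 (f v) (ex_intro2 _ _ v I erefl); rewrite /= in_itv.
have {}fw : f w = 0 by apply: fw; exists w.
have {}fV v : ~ V v -> f v = 1 by move=> nV; apply: fV; exists v.
(* Doubling and truncating yields 1 wherever [f] is below one half, and still 0 off [V]. *)
pose g v := Num.min (2 * (1 - f v)) 1.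
have gV v : ~ V v -> g v = 0.
  by move=> /fV; rewrite /g => ->; rewrite subrr mulr0 min_l.
have cg : continuous g.
  move=> v; apply: (@continuous_min _ _ (fun v => 2 * (1 - f v)) (cst 1)).
    apply: continuousM; first exact: cvg_cst.
    by apply: continuousB; [exact: cvg_cst|exact: cf].
  exact: cvg_cst.
have g0 : g \in @c0_pred R T.
  apply/mem_set; split=> // e e0.
  exists K => // v nK; rewrite gV ?normr0// => /VwK; exact: nK.
exists (C0Fun g0); split=> [v||v] /=.
- have /andP[? ?] := f01 v.
  by rewrite le_min ge_min lexx orbT ler01 !andbT mulr_ge0// subr_ge0.
- have : \forall v \near w, f v < 2^-1.
    by apply: (@cvgr_lt _ _ (nbhs w) _ f 0) => //; rewrite -fw; exact: cf.
  apply: filterS => v fv; rewrite /g min_r//.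
  by lra.
- by move=> /eqP gv; apply: VwU; apply: contrapT => /gV.
Qed.

End c0_theory.

(** * Lattice automorphisms as weighted composition operators *)

Section lataut_theory.
Context {R : realType} {T : topologicalType}.
Local Notation C0 := (c0 R T).
Implicit Types (S : lataut R T) (x y : C0) (w v : T).

HB.instance Definition _ S :=
  GRing.isLinear.Build R C0 C0 *:%R (lataut_fun S) (@lataut_linear _ _ S).

Lemma lataut_abs S x w : S (c0_abs x) w = `|S x w|.
Proof. by rewrite /c0_abs lataut_join linearN; exact: c0_absE. Qed.

Lemma lataut_le S x y : (forall v, x v <= y v) -> forall w, S x w <= S y w.
Proof.
move=> xy w; have -> : y = (x `|` y)%O by apply: c0P => v; rewrite c0_joinE max_r.
by rewrite lataut_join c0_joinE le_max lexx.
Qed.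

Lemma lataut_ge0 S x : (forall v, 0 <= x v) -> forall w, 0 <= S x w.
Proof.
move=> x0 w; have -> : x = c0_abs x.
  by apply: c0P => v; rewrite c0_absE ger0_norm.
by rewrite lataut_abs.
Qed.

Context (hT : hausdorff_space T) (lcT : locally_compact [set: T]).

(* The nonnegative kernel elements of [x |-> S x w] are directed upwards, so the
   covering property of K can be applied along the filter of their tails. *)
Lemma lataut_ker_dominating S w (K : set T) : compact K ->
  (forall p, exists x, [/\ forall v, 0 <= x v, 0 < x p & S x w = 0]) ->
  exists x, [/\ forall v, 0 <= x v, forall v, K v -> 1 <= x v & S x w = 0].
Proof.
move=> cK kerx.
pose D := [set x : C0 | (forall v, 0 <= x v) /\ S x w = 0].
pose B x := [set y : C0 | D y /\ forall v, x v <= y v].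
have FF : Filter (filter_from D B).
  apply: filter_from_filter.
    exists 0; split=> [v|]; first exact: lexx.
    by rewrite linear0.
  move=> x y [x0 Sx] [y0 Sy]; exists (x `|` y)%O.
    split=> [v|]; first by rewrite c0_joinE le_max x0.
    by rewrite lataut_join c0_joinE Sx Sy maxxx.
  move=> z [Dz zxy]; split; split=> // v; apply: le_trans (zxy v);
    by rewrite c0_joinE le_max lexx// orbT.
have /compact_near_coveringP cKn := cK.
have := cKn C0 (filter_from D B) (fun x v => 1 <= x v) FF.
case.
  move=> p _; have [x [x0 xp Sx]] := kerx p.
  (* The rescaled function is 2 at [p], hence exceeds 1 near [p], and so does everything above
     it. *)
  exists ([set v | 1 < ((2 / x p) *: x) v], B ((2 / x p) *: x)).
    split=> /=.
      apply: (cvgr_gt _ (@c0_continuous _ _ ((2 / x p) *: x) p)).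
      by rewrite -[ltRHS]/((2 / x p) * x p) divfK ?gt_eqF// ltr1n.
    exists ((2 / x p) *: x) => //; split=> [v|].
      by rewrite -[leRHS]/((2 / x p) * x v) mulr_ge0// divr_ge0// ltW.
    by rewrite linearZ -[LHS]/((2 / x p) * S x w) Sx mulr0.
  move=> [v z] /= [v1 [_ zx]]; exact/ltW/(lt_le_trans v1)/zx.
move=> x [x0 Sx] xK; exists x; split=> // v Kv.
by apply: (xK x) => //; split.
Qed.

(** The functional [x |-> S x w] is a nonzero lattice homomorphism. If every point had a nonnegative
    kernel element positive there, kernel elements would dominate on compact sets and the functional
    would vanish. At a point [p] without such an element, kernel elements vanish, so the functional
    is a multiple of evaluation at [p]. *)
Lemma lataut_point_ex S w : exists p c, 0 < c /\ forall x, S x w = c * x p.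
Proof.
have [p px] : exists p, forall x, (forall v, 0 <= x v) -> 0 < x p -> S x w != 0.
  apply: contrapT => /forallNP nex.
  have kerx p : exists x, [/\ forall v, 0 <= x v, 0 < x p & S x w = 0].
    apply: contrapT => nx; apply: (nex p) => x x0 xp; apply/eqP => Sx.
    by apply: nx; exists x.
  have [b [_ bw _]] := @c0_bump R T hT lcT w setT filterT.
  pose u := c0_abs (lataut_inv S b).
  have u0 v : 0 <= u v by rewrite c0_absE.
  have Su : S u w = 1.
    by rewrite lataut_abs latautVK (nbhs_singleton bw) normr1.
  (* [u <= e *: r] where [r < e], so [S u w] is controlled without knowing that
     [S] is bounded *)
  pose r := c0_sqrt u.
  have r0 v : 0 <= r v by rewrite sqrtr_ge0.
  have ur v : u v = r v * r v by rewrite -expr2 sqr_sqrtr.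
  have Sr0 : 0 <= S r w by exact: lataut_ge0.
  (* Chosen so that [e * S r w] is below 1, against [S u w = 1]. *)
  pose e := (2 * (S r w + 1))^-1.
  have e0 : 0 < e by rewrite invr_gt0 mulr_gt0// ltr_wpDl.
  have [K cK Kr] := @c0_vanishes _ _ r e e0.
  have [x [x0 xK Sx]] := lataut_ker_dominating cK kerx.
  (* On [K] the first summand dominates [u]; off [K] the second does, as [u = r * r] with
     [r < e]. *)
  have : S u w <= S (c0_norm u *: x + e *: r) w.
    apply: lataut_le => v.
    rewrite -[leRHS]/(c0_norm u * x v + e * r v).
    have [/xK x1|/Kr rv] := pselect (K v).
      rewrite ler_wpDr ?mulr_ge0// ?(ltW e0)//.
      have := c0_norm_ge u v; rewrite ger0_norm// => /le_trans; apply.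
      by rewrite ler_peMr// c0_norm_ge0.
    rewrite ler_wpDl ?mulr_ge0// ?c0_norm_ge0// ur ler_wpM2r//.
    by move: rv; rewrite ger0_norm// => /ltW.
  rewrite linearD !linearZ -[leRHS]/(c0_norm u * S x w + e * S r w) Sx Su mulr0 add0r.
  rewrite /e mulrC ler_pdivlMr ?mulr_gt0// ?ltr_wpDl//.
  by lra.
have [y [y01 yp _]] := @c0_bump R T hT lcT p setT filterT.
have {}yp : y p = 1 by exact: nbhs_singleton yp.
have y0 v : 0 <= y v by have /andP[] := y01 v.
have Sy0 : 0 <= S y w by exact: lataut_ge0.
exists p, (S y w); split=> [|x].
  by rewrite lt_def Sy0 px// yp.
(* A kernel element by construction, so its absolute value is one too and must vanish at [p]. *)
pose z := S x w *: y - S y w *: x.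
have Sz : S z w = 0.
  rewrite linearB !linearZ -[LHS]/(S x w * S y w + S y w * - S x w).
  by rewrite mulrN mulrC subrr.
have : ~ 0 < c0_abs z p.
  move=> zp; have := px (c0_abs z) _ zp.
  by rewrite lataut_abs Sz normr0 eqxx => /(_ _)/negP; apply=> // v; rewrite c0_absE.
rewrite c0_absE normr_gt0 => /negP; rewrite negbK => /eqP.
by rewrite -[z p]/(S x w * y p - S y w * x p) yp mulr1 => /eqP; rewrite subr_eq0 => /eqP.
Qed.

(** A bump at [p] vanishing at a different [p'] would force [c = 0]. *)
Lemma lataut_point_uniq p p' (c c' : R) : 0 < c ->
  (forall x, c * x p = c' * x p') -> p = p' /\ c = c'.
Proof.
move=> c0 cc'.
have pp' : p = p'.
  apply: contrapT => /eqP pp'.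
  have np : nbhs p (~` [set p']).
    apply: open_nbhs_nbhs; split; last by move=> /= /eqP; apply/negP.
    by rewrite openC; apply: accessible_closed_set1; exact: hausdorff_accessible.
  have [x [_ xp xU]] := @c0_bump R T hT lcT p _ np.
  have xp' : x p' = 0 by apply/eqP; apply: contrapT => /negP /xU; exact.
  have := cc' x; rewrite xp' (nbhs_singleton xp) mulr0 mulr1 => c00.
  by rewrite c00 ltxx in c0.
split=> //; subst p'.
have [x [_ xp _]] := @c0_bump R T hT lcT p setT filterT.
by have := cc' x; rewrite (nbhs_singleton xp) !mulr1.
Qed.

Definition lataut_point S w : T := projT1 (cid (lataut_point_ex S w)).

Definition lataut_weight S w : R :=
  projT1 (cid (projT2 (cid (lataut_point_ex S w)))).

Lemma lataut_weight_gt0 S w : 0 < lataut_weight S w.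
Proof. by have [] := projT2 (cid (projT2 (cid (lataut_point_ex S w)))). Qed.

Lemma lataut_weightE S w x :
  S x w = lataut_weight S w * x (lataut_point S w).
Proof. by have [] := projT2 (cid (projT2 (cid (lataut_point_ex S w)))). Qed.

(** Reduces identities for points and weights to writing [S x w] in the form [c * x p]. *)
Lemma lataut_weight_uniq S w p (c : R) : (forall x, S x w = c * x p) ->
  lataut_point S w = p /\ lataut_weight S w = c.
Proof.
move=> Sx; apply: lataut_point_uniq (lataut_weight_gt0 S w) _ => x.
by rewrite -lataut_weightE.
Qed.

Lemma lataut_mulE S S' w :
  lataut_point (S * S')%g w = lataut_point S' (lataut_point S w) /\
  lataut_weight (S * S')%g w =
    lataut_weight S w * lataut_weight S' (lataut_point S w).
Proof.
apply: lataut_weight_uniq => x.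
by rewrite -[LHS]/(S (S' x) w) !lataut_weightE mulrA.
Qed.

Lemma lataut_oneE w : lataut_point 1%g w = w /\ lataut_weight 1%g w = 1.
Proof. by apply: lataut_weight_uniq => x; rewrite mul1r. Qed.

(** * Joint continuity of points and weights, and boundedness of weights *)

Lemma lataut_eval_continuous x (S : lataut R T) :
  (fun S' : lataut R T => S' x) @ S --> S x.
Proof.
pose f : lataut R T -> {ptws C0 -> C0} := @lataut_fun R T.
have : f @ nbhs S --> f S by exact: initial_continuous.
by move=> /pointwise_cvgP/(_ x).
Qed.

(** The strong operator topology controls [S x] in the supremum norm, hence uniformly in the point
    of evaluation. *)
Lemma lataut_eval2_continuous x (Sw : lataut R T * T) :
  (fun Sw' : lataut R T * T => Sw'.1 x Sw'.2) @ Sw --> Sw.1 x Sw.2.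
Proof.
case: Sw => S w /=.
apply/cvgrPdist_lt => e e0.
have e20 : 0 < e / 2 by rewrite divr_gt0.
have /cvgrPdist_lt/(_ _ e20) nS := @lataut_eval_continuous x S.
have /cvgrPdist_lt/(_ _ e20) nw := @c0_continuous _ _ (S x) w.
exists ([set S' : lataut R T | `|S x - S' x| < e / 2],
  [set v | `|S x w - S x v| < e / 2]) => //.
move=> [S' v] /= [S'x vx].
rewrite [e]splitr -[X in `|X|](subrKA (S x v)).
rewrite (le_lt_trans (ler_normD _ _))// ltrD//.
exact: le_lt_trans (c0_norm_ge (S x - S' x) v) S'x.
Qed.

(** For a bump [x] that vanishes off [U], positivity of [S' x w'] is an open condition and forces
    the point into [U]. *)
Lemma lataut_point_near S w U : nbhs (lataut_point S w) U ->
  \forall Sw' \near (S, w), U (lataut_point Sw'.1 Sw'.2).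
Proof.
move=> /(@c0_bump R T hT lcT)[x [_ xp xU]].
have : 0 < S x w.
  by rewrite lataut_weightE (nbhs_singleton xp) mulr1 lataut_weight_gt0.
move=> Sx0.
have : nbhs (S, w) [set Sw' : lataut R T * T | 0 < Sw'.1 x Sw'.2].
  exact: (cvgr_gt _ (@lataut_eval2_continuous x (S, w))).
apply: filterS => -[S' w'] /=; rewrite lataut_weightE.
by rewrite pmulr_rgt0 ?lataut_weight_gt0// => x0; apply: xU; rewrite gt_eqF.
Qed.

Lemma lataut_point_continuous S : continuous (lataut_point S).
Proof.
move=> w U /lataut_point_near [[A B] /= [/nbhs_singleton AS Bw] ABU].
by apply: filterS Bw => v Bv; exact: (ABU (S, v)).
Qed.

(** Near [(S, w)] the points stay where a fixed bump [x] is 1, and there the weight is [S' x w']. *)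
Lemma lataut_weight_continuous S w :
  lataut_weight Sw'.1 Sw'.2 @[Sw' --> (S, w)] --> lataut_weight S w.
Proof.
have [x [_ xp _]] := @c0_bump R T hT lcT (lataut_point S w) setT filterT.
have -> : lataut_weight S w = S x w.
  by rewrite lataut_weightE (nbhs_singleton xp) mulr1.
apply: cvg_trans (@lataut_eval2_continuous x (S, w)).
apply: near_eq_cvg; have := lataut_point_near xp.
by apply: filterS => -[S' w'] /= x1; rewrite lataut_weightE x1 mulr1.
Qed.

(** Gliding hump: weights above [4 ^+ n] are tested on one [x] dominating bumps damped by
    [2^-1 ^+ n]. The values of [S x] then reach [2 ^+ n], although the orbit of [x] under [G] is
    compact and so norm bounded. *)
Lemma lataut_weight_bounded (G : set (lataut R T)) : compact G ->
  exists M, forall S w, G S -> lataut_weight S w <= M.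
Proof.
move=> cG; apply: contrapT => /forallNP nM.
have /choice[Sw Swn] : forall n : nat, exists Sw : lataut R T * T,
    G Sw.1 /\ 4 ^+ n < lataut_weight Sw.1 Sw.2.
  move=> n; have /existsNP[S /existsNP[w /not_implyP[GS /negP]]] := nM (4 ^+ n).
  by rewrite -ltNge => Mw; exists (S, w).
pose p n := lataut_point (Sw n).1 (Sw n).2.
have /choice[b bn] : forall n, exists x : C0,
    (forall v, 0 <= x v <= 1) /\ x (p n) = 1.
  move=> n; have [x [x01 xp _]] := @c0_bump R T hT lcT (p n) setT filterT.
  by exists x; split=> //; exact: nbhs_singleton xp.
have [x xb] := c0_dominating (fun n => (bn n).1).
have : compact ((fun S : lataut R T => S x : C0) @` G).
  apply: continuous_compact cG; apply: continuous_subspaceT => S.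
  exact: lataut_eval_continuous.
move=> /compact_bounded[M [_ MK]].
have {}MK S w : G S -> S x w <= M + 1.
  move=> GS; apply: le_trans (ler_norm _) _.
  apply: le_trans (c0_norm_ge _ _) _.
  by apply: (MK (M + 1)); [rewrite ltrDl|exists S].
have n2 n : 2 ^+ n <= M + 1.
  apply: le_trans (MK (Sw n).1 (Sw n).2 (Swn n).1).
  rewrite lataut_weightE -/(p n).
  apply: (@le_trans _ _ (4 ^+ n * 2^-1 ^+ n)).
    rewrite -exprMn [4 * 2^-1](_ : _ = 2)//.
    by rewrite -[4]/(4%:R) (natrM _ 2 2) mulfK.
  apply: ler_pM.
  - by rewrite exprn_ge0.
  - by rewrite exprn_ge0// invr_ge0.
  - exact/ltW/(Swn n).2.
  - by have := xb n (p n); rewrite (bn n).2 mulr1.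
have /archi_boundP : 0 <= `|M + 1| by [].
rewrite ltNge => /negP; apply.
apply: le_trans (ler_norm _); apply: le_trans (n2 (Num.bound `|M + 1|)).
by rewrite -natrX ler_nat ltnW// ltn_expl.
Qed.

End lataut_theory.

(** * Compactness and continuity in the strong operator topology *)

Section topology_of_operators.
Context {R : realType} {T : topologicalType}.
Local Notation C0 := (c0 R T).

(** Open sets of the initial topology are preimages, so any point of [A] above a cluster point of
    the image filter is itself a cluster point. It lets compactness in [homeo_sot] be checked on
    operators. *)
Lemma compact_initial (S : choiceType) (U : topologicalType) (f : S -> U)
    (A : set (initial_topology f)) : compact (f @` A) -> compact A.
Proof.
move=> cfA F PF FA.
have FfA : (fmap f F) (f @` A).
  exact: (@filterS _ F _ _ _ (@preimage_image _ _ f A) FA).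
have [_ [[a Aa <-] cl]] := cfA _ _ FfA; exists a; split=> // B V FB aV.
have [W [oW Oa] WV] : exists2 W : set (initial_topology f),
    open_nbhs a W & W `<=` V by move: aV; rewrite nbhsE => -[W]; exists W.
case: oW => O oO OW.
have : fmap f F (f @` B).
  exact: (@filterS _ F _ _ _ (@preimage_image _ _ f B) FB).
move=> /(cl _ O)/(_ _)[|_ [[b Bb <-] Ob]].
  by apply: open_nbhs_nbhs; split=> //; rewrite -OW in Oa.
by exists b; split=> //; apply: WV; rewrite -OW.
Qed.

Lemma mul_op_continuous (m : cbpp R T) : continuous (mul_op m : C0 -> C0).
Proof.
move=> x; have xF : Filter (nbhs x) by exact: nbhs_filter.
apply/cvgrPdist_le => e e0.
have [M [_ mM]] := cbpp_bounded m.
(* The added 1 makes [c] positive and strictly larger than [M], as [mM] requires. *)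
pose c := `|M| + 1.
have c0 : 0 < c by rewrite ltr_wpDl.
have mc w : m w <= c.
  apply: le_trans (ler_norm _) _; apply: (mM c) => //.
  by rewrite (le_lt_trans (ler_norm _))// ltrDl.
have /cvgrPdist_le/(_ (e / c) ltac:(by rewrite divr_gt0)) :=
  (@cvg_id _ (nbhs x)).
apply: filterS => y /= xy; apply: c0_norm_le => [|w]; first exact: ltW.
rewrite -[(_ - _ : C0) w]/(m w * x w - m w * y w) -mulrBr normrM.
rewrite gtr0_norm ?cbpp_gt0// (le_trans (ler_wpM2r _ (mc w)))//.
rewrite mulrC -ler_pdivlMr//; apply: le_trans xy.
exact: (c0_norm_ge (x - y)).
Qed.

Lemma mul_op_conj_continuous (m : cbpp R T) :
  continuous (fun S : lataut R T => mul_op m * S * (mul_op m)^-1)%g.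
Proof.
apply: continuous_comp_initial => S.
have SF : Filter (nbhs S) by exact: nbhs_filter.
apply/(@pointwise_cvgP _ _ _ _ (fmap_filter _ SF)) => x.
apply: (@continuous_comp _ _ _ (fun S : lataut R T => S ((mul_op m)^-1%g x))
  (mul_op m)).
  exact: lataut_eval_continuous.
exact: mul_op_continuous.
Qed.

End topology_of_operators.

(** * Conjugates of composition operators by multipliers *)

Section conj_comp_op.
Context {R : realType} {T : topologicalType}.
Implicit Types (m : cbpp R T) (h k : homeo_sot R T).

Definition conj_comp m h : lataut R T :=
  (mul_op m * comp_op R h * (mul_op m)^-1)%g.

Lemma conj_compE m h (x : c0 R T) w :
  conj_comp m h x w = m w * (m (homeo_inv h w))^-1 * x (homeo_inv h w).
Proof. by rewrite -mulrA. Qed.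

Lemma conj_compM m h k :
  conj_comp m (h * k)%g = (conj_comp m h * conj_comp m k)%g.
Proof. by rewrite /conj_comp comp_opM !mulgA mulgVK. Qed.

Lemma conj_comp1 m : conj_comp m 1%g = 1%g.
Proof.
apply: (@mulgI _ (conj_comp m 1%g)).
by rewrite -conj_compM mulg1 mulg1.
Qed.

Lemma conj_compV m h : conj_comp m (h^-1)%g = (conj_comp m h)^-1%g.
Proof.
by apply: (@mulgI _ (conj_comp m h)); rewrite -conj_compM !mulgV conj_comp1.
Qed.

Lemma conj_group_compact_group m (H : set (homeo_sot R T)) :
  compact_group H -> compact_group (conj_group m H).
Proof.
move=> [[H1 HD] cH]; split.
  split; first by apply/mem_set; exists 1%g; [exact: set_mem H1|exact: conj_comp1].
  move=> _ _ /set_mem[h Hh <-] /set_mem[k Hk <-].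
  apply/mem_set; exists (h / k)%g.
    exact: set_mem (HD h k (mem_set Hh) (mem_set Hk)).
  by rewrite -!/(conj_comp _ _) conj_compM conj_compV.
(* A continuous image of [H]: [comp_op] is continuous by the choice of topology on [homeo_sot], and
   conjugation by a fixed multiplier is continuous. *)
rewrite (_ : conj_group m H =
  (fun S : lataut R T => mul_op m * S * (mul_op m)^-1)%g @` (@comp_op R T @` H)).
  apply: continuous_compact.
    apply: continuous_subspaceT; exact: mul_op_conj_continuous.
  apply: continuous_compact cH; apply: continuous_subspaceT.
  exact: initial_continuous.
by rewrite image_comp.
Qed.

Context (hT : hausdorff_space T) (lcT : locally_compact [set: T]).

(** The multiplier only affects the weight; the point at [w] is the preimage of [w] under [h], which
    the operator determines. *)
Lemma conj_comp_inj m m' h h' : conj_comp m h = conj_comp m' h' -> h = h'.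
Proof.
move=> hh'; apply: (can_inj (@invgK _)); apply: homeoP => w.
have c0 (n : cbpp R T) v v' : 0 < n v * (n v')^-1.
  by rewrite divr_gt0// cbpp_gt0.
apply: (lataut_point_uniq hT lcT (c0 m w (homeo_inv h w)) _).1 => x.
by rewrite -conj_compE hh' conj_compE.
Qed.

Lemma conj_group_inj m m' (H H' : set (homeo_sot R T)) :
  conj_group m H = conj_group m' H' -> H = H'.
Proof.
have sub n n' (K K' : set (homeo_sot R T)) :
    conj_group n K = conj_group n' K' -> K `<=` K'.
  move=> KK' h Kh.
  have : conj_group n K (conj_comp n h) by exists h.
  by rewrite KK' => -[h' K'h' /(@conj_comp_inj _ _ _ _) <-].
by move=> HH'; apply/seteqP; split; [exact: sub HH'|exact: sub (esym HH')].
Qed.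

End conj_comp_op.

(** * Untwisting a compact group by the supremum of its weights *)

Section compact_group_of_lattice_automorphisms.
Context {R : realType} {T : topologicalType}.
Context (hT : hausdorff_space T) (lcT : locally_compact [set: T]).
Local Notation point := (lataut_point hT lcT).
Local Notation weight := (lataut_weight hT lcT).

Lemma lataut_pointK (S S' : lataut R T) : (S * S' = 1)%g ->
  cancel (point S) (point S').
Proof.
by move=> SS' w; rewrite -(lataut_mulE hT lcT S S' w).1 SS' (lataut_oneE _ _ _).1.
Qed.

(* [homeo] acts by [x |-> x \o h^-1], so [point S] is the inverse of the
   homeomorphism underlying [S]. *)
Definition lataut_homeo (S : lataut R T) : homeo_sot R T :=
  Homeo (@lataut_point_continuous R T hT lcT S^-1%g)
    (@lataut_point_continuous R T hT lcT S)
    (lataut_pointK (mulVg S)) (lataut_pointK (mulgV S)).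

Lemma lataut_homeoM S S' :
  lataut_homeo (S * S')%g = (lataut_homeo S * lataut_homeo S')%g.
Proof.
(* Inverses are compared because [point] reverses products. *)
apply: (can_inj (@invgK _)); apply: homeoP => w.
exact: (lataut_mulE hT lcT S S' w).1.
Qed.

Lemma lataut_homeo1 : lataut_homeo 1%g = 1%g.
Proof.
by apply: (@mulgI _ (lataut_homeo 1%g)); rewrite -lataut_homeoM mulg1 mulg1.
Qed.

Lemma lataut_homeoV S : lataut_homeo S^-1%g = (lataut_homeo S)^-1%g.
Proof.
by apply: (@mulgI _ (lataut_homeo S)); rewrite -lataut_homeoM !mulgV lataut_homeo1.
Qed.

Context (G : set (lataut R T)) (GG : compact_group G).

Let cG : compact G := GG.2.
Let G1 : G 1%g. Proof. exact: set_mem GG.1.1. Qed.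
Let GV S : G S -> G S^-1%g.
Proof. by move=> /mem_set /(group_closedV GG.1)/set_mem. Qed.
Let GM S S' : G S -> G S' -> G (S * S')%g.
Proof.
by move=> /mem_set GS /mem_set GS'; exact: set_mem (group_closedM GG.1 GS GS').
Qed.

Definition sup_weight (w : T) := sup [set weight S w | S in G].

Lemma sup_weight_ge S w : G S -> weight S w <= sup_weight w.
Proof.
move=> GS; apply: ub_le_sup; last by exists S.
have [M GM'] := lataut_weight_bounded hT lcT cG.
by exists M => _ [S' GS' <-]; exact: GM'.
Qed.

Lemma sup_weight_le M w : (forall S, G S -> weight S w <= M) ->
  sup_weight w <= M.
Proof.
move=> SM; apply: ge_sup => [|_ [S GS <-]]; last exact: SM.
by exists (weight 1%g w), 1%g.
Qed.

Lemma sup_weight_ge1 w : 1 <= sup_weight w.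
Proof. by rewrite -(lataut_oneE hT lcT w).2; exact: sup_weight_ge. Qed.

Lemma sup_weight_bounded : bounded_fun sup_weight.
Proof.
have [M GM'] := lataut_weight_bounded hT lcT cG.
exists M; split; first exact: num_real.
move=> N /ltW MN w _; rewrite /= ger0_norm.
  by apply: le_trans MN; apply: sup_weight_le => S; exact: GM'.
exact: le_trans (sup_weight_ge1 w).
Qed.

(** The lower estimate follows from continuity of the weight of one nearly maximal [S]. The upper
    one needs a single neighbourhood of [w] for all [S] in [G], which compactness of [G]
    supplies. *)
Lemma sup_weight_continuous : continuous sup_weight.
Proof.
move=> w; apply/cvgrPdist_le => e e0.
have e20 : 0 < e / 2 by rewrite divr_gt0.
have lsc : \forall v \near w, sup_weight w - e <= sup_weight v.
  have [_ [S GS <-] Sw] : exists2 r, [set weight S w | S in G] r &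
      sup_weight w - e / 2 < r.
    apply: sup_adherent => //; split; first by exists (weight 1%g w), 1%g.
    have [M GM'] := lataut_weight_bounded hT lcT cG.
    by exists M => _ [S' GS' <-]; exact: GM'.
  have /cvgrPdist_lt/(_ _ e20) := @lataut_weight_continuous R T hT lcT S w.
  move=> [[A B] /= [/nbhs_singleton AS Bw] AB].
  apply: filterS Bw => v Bv; apply: le_trans (sup_weight_ge v GS).
  have := AB (S, v) (conj AS Bv); rewrite /= ltr_norml => /andP[_ ?].
  lra.
have usc : \forall v \near w, forall S, G S -> weight S v <= sup_weight w + e.
  have /compact_near_coveringP cGn := cG.
  apply: (cGn T (nbhs w) (fun v S => weight S v <= sup_weight w + e)).
  move=> S GS.
  have /cvgrPdist_lt/(_ _ e0) := @lataut_weight_continuous R T hT lcT S w.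
  apply: filterS => -[S' v] /=; rewrite ltr_norml => /andP[Sv _].
  have := sup_weight_ge w GS; lra.
apply: filterS2 lsc usc => v lv uv.
have {}uv : sup_weight v <= sup_weight w + e by exact: sup_weight_le.
by rewrite ler_norml; apply/andP; split; lra.
Qed.

Definition sup_weight_cbpp : cbpp R T :=
  Cbpp sup_weight_continuous sup_weight_bounded
    (ex_intro2 _ _ 1 ltr01 sup_weight_ge1).

(* Multiplying by [S] permutes [G], which turns the cocycle identity of [weight]
   into a coboundary equation for its supremum. *)
Lemma sup_weight_cocycle S w : G S ->
  sup_weight w = weight S w * sup_weight (point S w).
Proof.
move=> GS; have S0 := lataut_weight_gt0 hT lcT S w.
apply/eqP; rewrite eq_le; apply/andP; split.
  apply: sup_weight_le => S' GS'.
  have -> : S' = (S * (S^-1 * S'))%g by rewrite mulVKg.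
  rewrite (lataut_mulE _ _ _ _ _).2 ler_pM2l//.
  by apply: sup_weight_ge; apply: GM => //; exact: GV.
rewrite mulrC -ler_pdivlMr//; apply: sup_weight_le => S' GS'.
rewrite ler_pdivlMr// mulrC -(lataut_mulE _ _ _ _ _).2.
by apply: sup_weight_ge; exact: GM.
Qed.

Lemma conj_comp_lataut_homeo S : G S ->
  conj_comp sup_weight_cbpp (lataut_homeo S) = S.
Proof.
move=> GS; apply: latautP => x; apply: c0P => w.
(* The quotient of the values of [sup_weight] at [w] and [point S w] is the weight of [S] at [w]. *)
rewrite conj_compE /= (sup_weight_cocycle w GS) mulfK; last first.
  by rewrite gt_eqF// (lt_le_trans ltr01)// sup_weight_ge1.
by rewrite -lataut_weightE.
Qed.

Lemma conj_group_lataut_homeo :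
  conj_group sup_weight_cbpp (lataut_homeo @` G) = G.
Proof.
apply/seteqP; split=> [_ [_ [S GS <-] <-]|S GS].
  by rewrite -/(conj_comp _ _) conj_comp_lataut_homeo.
exists (lataut_homeo S); first by exists S.
exact: conj_comp_lataut_homeo.
Qed.

Lemma lataut_homeo_compact_group : compact_group (lataut_homeo @` G).
Proof.
split.
  split; first by apply/mem_set; exists 1%g => //; exact: lataut_homeo1.
  move=> _ _ /set_mem[S GS <-] /set_mem[S' GS' <-].
  apply/mem_set; exists (S / S')%g; first by apply: GM => //; exact: GV.
  by rewrite lataut_homeoM lataut_homeoV.
apply: compact_initial.
(* Conjugating [G] back by the inverse multiplier gives the composition operators of the
   homeomorphisms, so their set is compact. *)
pose m' := cbpp_inv sup_weight_cbpp.
rewrite (_ : _ @` _ =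
  (fun S : lataut R T => mul_op m' * S * (mul_op m')^-1)%g @` G).
  apply: continuous_compact cG; apply: continuous_subspaceT.
  exact: mul_op_conj_continuous.
rewrite image_comp; apply: eq_imagel => S GS /=.
have -> : mul_op m' = (mul_op sup_weight_cbpp)^-1%g by exact: latautP.
rewrite invgK -[in RHS](conj_comp_lataut_homeo GS) /conj_comp.
by rewrite !mulgA mulVg mul1g mulgVK.
Qed.

End compact_group_of_lattice_automorphisms.

Theorem theorem6p4 (R : realType) (Omega : topologicalType)
    (hausdorff_Omega : hausdorff_space Omega)
    (locally_compact_Omega : locally_compact [set: Omega]) :
  (forall G : set (lataut R Omega), compact_group G ->
     exists! H : set (homeo_sot R Omega),
       compact_group H /\ exists m : cbpp R Omega, G = conj_group m H) /\
  (forall (H : set (homeo_sot R Omega)) (m : cbpp R Omega),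
     compact_group H -> compact_group (conj_group m H)).
Proof.
split=> [G GG|H m]; last exact: conj_group_compact_group.
have GE := conj_group_lataut_homeo hausdorff_Omega locally_compact_Omega GG.
exists (lataut_homeo hausdorff_Omega locally_compact_Omega @` G).
split=> [|H [_ [m Gm]]].
  split; first exact: lataut_homeo_compact_group.
  by exists (sup_weight_cbpp hausdorff_Omega locally_compact_Omega GG).
by move: GE; rewrite [RHS]Gm => /conj_group_inj; apply.
Qed.
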